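(* Let $W\in\mathcal{W}^{n}$ and let $A$ be a non-empty closed subset of $W$. If there is a point $p\in A$ that sees $\partial A$ via $A$ (that is, $[pq]\subset A$ for every $q\in\partial A$), then $A$ is starshaped.
   Context: $\mathcal{W}^{n}$ is the class of $C^{\infty}$ complete simply connected $n$-dimensional Riemannian manifolds without conjugate points (every nontrivial Jacobi field along every geodesic vanishes at most once). In such a manifold $W$ any two distinct points $p,q$ are joined by a unique geodesic; $[pq]$ denotes the closed geodesic segment joining them. $A\subset W$ is starshaped if there is a point $p\in A$ with $[pq]\subset A$ for every $q\in A$. $\partial A$ is the topological boundary of $A$ in $W$. *)

(* Defs.v *)
From HB Require Import structures.
From mathcomp Require Import all_boot all_order all_algebra.
From mathcomp Require Import all_classical all_reals all_analysis.

Set Implicit Arguments.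
Unset Strict Implicit.
Unset Printing Implicit Defensive.
Import Order.TTheory GRing.Theory Num.Theory.
Import numFieldNormedType.Exports.
Local Open Scope classical_set_scope.
Local Open Scope ring_scope.

(* Everything is expressed in charts: points of the model space are row vectors,
   and a linear map acts on them by multiplication on the right, as in the
   library's [jacobian]. *)

Definition basis_vec (R : realType) (n : nat) (i : 'I_n) : 'rV[R]_n :=
  delta_mx ord0 i.

(* U is meant to be open, so that the values of f outside U are irrelevant. *)
Fixpoint Ck_on (R : realType) (n : nat) (V : normedModType R) (k : nat)
    (U : set 'rV[R]_n) (f : 'rV[R]_n -> V) : Prop :=
  (forall x, U x -> {for x, continuous f}) /\
  match k with
  | 0%N => True
  | k'.+1 => forall i : 'I_n,
      (forall x, U x -> derivable f x (basis_vec R i)) /\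
      Ck_on k' U ('D_(basis_vec R i) f)
  end.

Definition smooth_on (R : realType) (n : nat) (V : normedModType R)
    (U : set 'rV[R]_n) (f : 'rV[R]_n -> V) : Prop :=
  forall k, Ck_on k U f.

(* The atlas need not be maximal. [param c] is the inverse of the chart
   [coord c : dom c -> coord c @` dom c]; both are total functions whose values
   outside these sets are irrelevant. *)
Record manifold (R : realType) (n : nat) := Manifold {
  point :> topologicalType ;
  chart : Type ;
  dom : chart -> set point ;
  coord : chart -> point -> 'rV[R]_n ;
  param : chart -> 'rV[R]_n -> point ;
  manifold_hausdorff : hausdorff_space point ;
  manifold_second_countable : @second_countable point ;
  dom_open : forall c, open (dom c) ;
  dom_cover : forall p, exists c, dom c p ;
  coord_open : forall c, open (coord c @` dom c) ;
  coordK : forall c p, dom c p -> param c (coord c p) = p ;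
  coord_continuous : forall c p, dom c p -> {for p, continuous (coord c)} ;
  param_continuous : forall c p, dom c p ->
    {for coord c p, continuous (param c)} ;
  transition_smooth : forall c d,
    smooth_on (coord c @` (dom c `&` dom d)) (coord d \o param c)
}.

Definition transition (R : realType) (n : nat) (M : manifold R n)
    (c d : chart M) : 'rV[R]_n -> 'rV[R]_n := @coord R n M d \o @param R n M c.

(* [metric c x] is the Gram matrix of the coordinate vector fields of the chart
   c at the point with coordinates x. *)
Record riemannian_manifold (R : realType) (n : nat) := RiemannianManifold {
  base_manifold :> manifold R n ;
  metric : chart base_manifold -> 'rV[R]_n -> 'M[R]_n ;
  metric_sym : forall c p, dom c p ->
    (metric c (coord c p))^T = metric c (coord c p) ;
  metric_posdef : forall c p, dom c p -> forall v : 'rV[R]_n, v != 0 ->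
    0 < (v *m metric c (coord c p) *m v^T) ord0 ord0 ;
  metric_smooth : forall c, smooth_on (coord c @` dom c) (metric c) ;
  metric_transition : forall c d p, dom c p -> dom d p ->
    metric c (coord c p) =
      'J (transition c d) (coord c p) *m metric d (coord d p) *m
      ('J (transition c d) (coord c p))^T
}.

(* Gamma^k_ij
     = 1/2 sum_l g^kl (partial_i g_jl + partial_j g_il - partial_l g_ij). *)
Definition christoffel (R : realType) (n : nat) (W : riemannian_manifold R n)
    (c : chart W) (k i j : 'I_n) (x : 'rV[R]_n) : R :=
  2^-1 * \sum_(l < n) invmx (metric c x) k l *
    ('D_(basis_vec R i) (fun y => metric c y j l) x
     + 'D_(basis_vec R j) (fun y => metric c y i l) x
     - 'D_(basis_vec R l) (fun y => metric c y i j) x).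

(* The k-th component of R(partial_i, partial_j) partial_l, with the convention
   R(X, Y) Z = nabla_X nabla_Y Z - nabla_Y nabla_X Z - nabla_[X, Y] Z. *)
Definition curvature (R : realType) (n : nat) (W : riemannian_manifold R n)
    (c : chart W) (k i j l : 'I_n) (x : 'rV[R]_n) : R :=
  'D_(basis_vec R i) (christoffel c k j l) x
  - 'D_(basis_vec R j) (christoffel c k i l) x
  + \sum_(m < n) (christoffel c k i m x * christoffel c m j l x
                  - christoffel c k j m x * christoffel c m i l x).

Definition local_curve (R : realType) (n : nat) (M : manifold R n)
    (gamma : R -> M) (c : chart M) (t : R) : 'rV[R]_n := coord c (gamma t).

(* Covariant derivative along gamma of the vector field with components V in
   the chart c. *)
Definition cov_deriv (R : realType) (n : nat) (W : riemannian_manifold R n)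
    (gamma : R -> W) (c : chart W) (V : R -> 'rV[R]_n) (t : R) : 'rV[R]_n :=
  let x := local_curve gamma c in
  \row_(k < n) (derive1 V t ord0 k
    + \sum_(i < n) \sum_(j < n)
        christoffel c k i j (x t) * derive1 x t ord0 i * V t ord0 j).

(* I is meant to be open. Twice differentiable solutions of the geodesic
   equation are automatically of class C^oo. *)
Definition geodesic_on (R : realType) (n : nat) (W : riemannian_manifold R n)
    (I : set R) (gamma : R -> W) : Prop :=
  forall t, I t ->
    {for t, continuous gamma} /\
    forall c : chart W, dom c (gamma t) ->
      let x := local_curve gamma c in
      [/\ derivable x t 1, derivable (derive1 x) t 1 &
          cov_deriv gamma c (derive1 x) t = 0].

Definition geodesic_line (R : realType) (n : nat) (W : riemannian_manifold R n)
    (gamma : R -> W) : Prop := geodesic_on setT gamma.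

(* Geodesic completeness; by Hopf-Rinow it agrees with metric completeness. *)
Definition complete_manifold (R : realType) (n : nat)
    (W : riemannian_manifold R n) : Prop :=
  forall (a b : R) (gamma : R -> W), a < b -> geodesic_on `]a, b[ gamma ->
    exists2 delta : R -> W, geodesic_line delta &
      forall t, t \in `]a, b[ -> delta t = gamma t.

(* [J c t] are the components in the chart c of the value at t, a tangent
   vector at [gamma t]; they only matter when [gamma t] lies in [dom c]. *)
Definition vector_field_along (R : realType) (n : nat) (M : manifold R n)
    (gamma : R -> M) (J : chart M -> R -> 'rV[R]_n) : Prop :=
  forall c d t, dom c (gamma t) -> dom d (gamma t) ->
    J d t = J c t *m 'J (transition c d) (local_curve gamma c t).

Definition vanishes_at (R : realType) (n : nat) (M : manifold R n)
    (gamma : R -> M) (J : chart M -> R -> 'rV[R]_n) (t : R) : Prop :=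
  forall c : chart M, dom c (gamma t) -> J c t = 0.

(* D^2 J / dt^2 + R(J, gamma') gamma' = 0 *)
Definition jacobi_field (R : realType) (n : nat) (W : riemannian_manifold R n)
    (gamma : R -> W) (J : chart W -> R -> 'rV[R]_n) : Prop :=
  vector_field_along gamma J /\
  forall (t : R) (c : chart W), dom c (gamma t) ->
    let x := local_curve gamma c in
    [/\ derivable (J c) t 1, derivable (derive1 (J c)) t 1 &
      forall k : 'I_n,
        cov_deriv gamma c (cov_deriv gamma c (J c)) t ord0 k
        + \sum_(i < n) \sum_(j < n) \sum_(l < n)
            curvature c k i j l (x t) * J c t ord0 i
              * derive1 x t ord0 j * derive1 x t ord0 l = 0].

(* By completeness it suffices to consider geodesics defined on the whole real
   line. *)
Definition no_conjugate_points (R : realType) (n : nat)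
    (W : riemannian_manifold R n) : Prop :=
  forall (gamma : R -> W) (J : chart W -> R -> 'rV[R]_n),
    geodesic_line gamma -> jacobi_field gamma J ->
    (exists t, ~ vanishes_at gamma J t) ->
    forall s t, vanishes_at gamma J s -> vanishes_at gamma J t -> s = t.

Definition path_connected (R : realType) (T : topologicalType) : Prop :=
  forall p q : T, exists gamma : R -> T,
    [/\ {within `[0, 1], continuous gamma}, gamma 0 = p & gamma 1 = q].

Definition simply_connected (R : realType) (T : topologicalType) : Prop :=
  path_connected R T /\
  forall gamma : R -> T,
    {within `[0, 1], continuous gamma} -> gamma 0 = gamma 1 ->
    exists H : R * R -> T,
      [/\ {within `[0, 1] `*` `[0, 1], continuous H},
          forall t, t \in `[0, 1] -> H (0, t) = gamma t,
          forall t, t \in `[0, 1] -> H (1, t) = gamma 0 &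
          forall s, s \in `[0, 1] -> H (s, 0) = gamma 0 /\ H (s, 1) = gamma 0].

Definition class_W (R : realType) (n : nat) (W : riemannian_manifold R n) :
    Prop :=
  [/\ complete_manifold W, simply_connected R W & no_conjugate_points W].

(* The geodesic segment [pq]. For W in the class [class_W] the geodesic
   gamma : [0, 1] -> W from p to q exists and is unique, so that this set is its
   image; in particular [pp] = {p}. *)
Definition geodesic_segment (R : realType) (n : nat)
    (W : riemannian_manifold R n) (p q : W) : set W :=
  [set x | exists gamma : R -> W,
     [/\ geodesic_line gamma, gamma 0 = p, gamma 1 = q &
         (gamma @` `[0, 1]) x]].

Definition boundary (T : topologicalType) (A : set T) : set T :=
  closure A `\` A^°.

Definition sees_via (R : realType) (n : nat) (W : riemannian_manifold R n)
    (A : set W) (p : W) (S : set W) : Prop :=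
  forall q, S q -> geodesic_segment p q `<=` A.

Definition starshaped (R : realType) (n : nat) (W : riemannian_manifold R n)
    (A : set W) : Prop :=
  exists2 p, A p & forall q, A q -> geodesic_segment p q `<=` A.

(* Main.v *)
Require Import Defs.
From HB Require Import structures.
From mathcomp Require Import all_boot all_order all_algebra.
From mathcomp Require Import all_classical all_reals all_analysis.
Import Order.TTheory GRing.Theory Num.Theory.
Import numFieldNormedType.Exports.
Local Open Scope classical_set_scope.
Local Open Scope ring_scope.

(** The point p that sees the boundary of A sees all of A. Let q be in A, let
    gamma be a geodesic with gamma 0 = p and gamma 1 = q, and suppose that some
    gamma s with 0 <= s <= 1 is outside the closed set A. Running along gamma
    from s to 1, one enters A for the first time at some t > s, and gamma t is
    then a boundary point of A ([path_enters_through_boundary]). The rescaled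
    curve u |-> gamma (t * u) is a geodesic from p to gamma t
    ([geodesic_line_scale]), and it passes through gamma s at u = s / t, so
    gamma s lies on a segment from p to a boundary point, hence in A: a
    contradiction. *)

(** The first parameter at which the path is in A exists by compactness. At
    that parameter the path cannot be in the interior of A: it would already
    have been in A slightly earlier. *)
Lemma path_enters_through_boundary {R : realType} {T : topologicalType}
    {A : set T} {gamma : R -> T} {a b : R} :
  closed A -> continuous gamma -> a <= b -> ~ A (gamma a) -> A (gamma b) ->
  exists2 t, a < t <= b & boundary A (gamma t).
Proof.
move=> clA cgamma ab nAa Ab.
pose S := `[a, b]%classic `&` gamma @^-1` A.
have S0 : S !=set0 by exists b; split => //=; rewrite in_itv /= ab lexx.
have cS : compact S.
  apply: compact_closedI; first exact: segment_compact.
  exact: preimage_closed.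
have cid : {within S, continuous (id : R -> R)}.
  by apply: continuous_subspaceT => u; exact: cvg_id.
have [t [/= tab At] tmin] : exists2 t : R, S t & forall u, S u -> t <= u.
  have [t /set_mem St tmin] := compact_EVT_min S0 cS cid.
  by exists t => // u /mem_set; exact: tmin.
move: tab; rewrite in_itv /= => /andP[at_ tb].
have {}at_ : a < t.
  by rewrite lt_neqAle at_ andbT; apply/eqP => ta; apply: nAa; rewrite ta.
exists t; first by rewrite at_.
split; first exact: subset_closure At.
move=> intA.
have nearA : \forall u \near t, A (gamma u) by exact: cgamma intA.
have nearA' : \forall u \near t^'-, A (gamma u) /\ a < u < t.
  near=> u; split; first by near: u; exact: cvg_at_left_filter nearA.
  by apply/andP; split; near: u; [exact: nbhs_left_gt|exact: nbhs_left_lt].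
have [u [Au /andP[au ut]]] :=
  @filter_ex _ _ (at_left_proper_filter t) _ nearA'.
have Su : S u.
  by split => //=; rewrite in_itv /= (ltW au) (le_trans (ltW ut)).
by have := tmin u Su; rewrite leNgt ut.
Unshelve. all: by end_near. Qed.

Lemma is_derive_scale {R : realType} {V : normedModType R} {f : R -> V}
    {a u : R} :
  derivable f (a * u) 1 ->
  is_derive u 1 (f \o *%R a) (a *: derive1 f (a * u)).
Proof.
move=> /derivable1_diffP df.
have da : differentiable ( *%R a) u by exact/derivable1_diffP.
have dfa : differentiable (f \o *%R a) u by exact: differentiable_comp.
apply: DeriveDef; first exact/derivable1_diffP.
rewrite deriveE // diff_comp //= (diff1E da) (diff1E df) scale1r.
rewrite derive1E deriveM // derive_id derive_cst scaler0 addr0.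
by congr (_ *: _); exact: mulr1.
Qed.

Lemma geodesic_line_continuous {R : realType} {n : nat}
    {W : riemannian_manifold R n} {gamma : R -> W} :
  geodesic_line gamma -> continuous gamma.
Proof. by move=> g t; have [] := g t I. Qed.

(** Every summand of the geodesic equation contains either one second derivative
    or two first derivatives of the curve, so it scales by a * a. *)
Lemma geodesic_line_scale (R : realType) (n : nat) (W : riemannian_manifold R n)
    (gamma : R -> W) (a : R) :
  geodesic_line gamma -> geodesic_line (gamma \o *%R a).
Proof.
move=> g u _.
have cgamma := geodesic_line_continuous g.
have cga : continuous (gamma \o *%R a).
  move=> v; apply: continuous_comp; last exact: cgamma.
  exact: mulrl_continuous.
split; first exact: cga.
move=> c cu x.
pose y := local_curve gamma c.
have [_ /(_ c cu)[dy ddy eqy]] := g (a * u) I.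
(* The derivative of x must be known on a neighbourhood of u, because it is
   differentiated once more. *)
have dx : \forall v \near u, derive1 x v = a *: derive1 y (a * v).
  have : \forall v \near u, dom c (gamma (a * v)).
    by apply: cga; apply: open_nbhs_nbhs; split => //; exact: dom_open.
  apply: filterS => v cv.
  have [_ /(_ c cv)[dyv _ _]] := g (a * v) I.
  by rewrite derive1E; have [_ ->] := is_derive_scale dyv.
have ddx : is_derive u 1 (derive1 x) (a *: (a *: derive1 (derive1 y) (a * u))).
  have [d1 d2] := is_derive_scale ddy.
  apply: (near_eq_is_derive (f := a \*: (derive1 y \o *%R a))).
    by apply: filterS dx => v ->.
  by rewrite -d2; apply: is_deriveZ; exact: derivableP.
split.
- by have [] := is_derive_scale dy.
- by have [] := ddx.
apply/rowP => k; move/rowP/(_ k): eqy; rewrite !mxE => eqy.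
rewrite derive1E; have [_ ->] := ddx.
rewrite (nbhs_singleton dx) !mxE -[RHS](mulr0 (a * a)) -[in RHS]eqy.
rewrite mulrDr mulrA; congr (_ + _).
rewrite mulr_sumr; apply: eq_bigr => i _.
rewrite mulr_sumr; apply: eq_bigr => j _.
by rewrite !mxE (mulrCA (christoffel _ _ _ _ _) a) mulrACA.
Qed.

Theorem proposition1 (R : realType) (n : nat) (W : riemannian_manifold R n)
    (A : set W) :
  class_W W -> A !=set0 -> closed A ->
  (exists2 p, A p & sees_via A p (boundary A)) ->
  starshaped A.
Proof.
move=> _ _ clA [p Ap psees]; exists p => // q Aq x [gamma [g g0 g1]].
move=> [s /=]; rewrite in_itv /= => /andP[s0 s1] <-.
apply: contrapT => nAs.
have [|t /andP[st t1] bt] := path_enters_through_boundary clA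
  (geodesic_line_continuous g) s1 nAs.
  by rewrite g1.
have t0 : 0 < t := le_lt_trans s0 st.
apply: nAs; apply: (psees _ bt).
exists (gamma \o *%R t); split => /=.
- exact: geodesic_line_scale.
- by rewrite mulr0.
- by rewrite mulr1.
exists (s / t) => /=; last by rewrite mulrCA divff ?mulr1 // gt_eqF.
by rewrite in_itv /= divr_ge0 ?(ltW t0) // ler_pdivrMr // mul1r ltW.
Qed.
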